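(* Suppose the control system $F(x,\dot x)=0$ is differentially flat, let $\varphi:(\mathbb{R}^m)^{r+1}\to\mathbb{R}^n$ be a parameter function associated to the flat system (that is, a parameter function $\varphi$ for which a function $\psi$ as in the definition of differential flatness exists), and let $$\Phi:(y_0,\dots,y_{r+1})\mapsto\bigl(\varphi(y_0,\dots,y_r),\ \mathcal{L}_\tau\varphi(y_0,\dots,y_{r+1})\bigr),\qquad (y_0,\dots,y_{r+1})\in(\mathbb{R}^m)^{r+2}.$$ Then the restriction of $\Phi$ to the elements of the form $(y_0,0,\dots,0)$, $y_0\in\mathbb{R}^m$, is a diffeomorphism onto the equilibrium manifold $F(x_0,0)=0$, i.e. $y_0\mapsto \varphi(y_0,0,\dots,0)$ is a diffeomorphism from $\mathbb{R}^m$ onto $\{x_0\in\mathbb{R}^n : F(x_0,0)=0\}$ (where $x_0$ is identified with $(x_0,0)$).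
   Context: Setting. Let $n>m>0$ be integers and let $F:\mathbb{R}^n\times\mathbb{R}^n\to\mathbb{R}^{n-m}$, $(x,p)\mapsto F(x,p)$, be a smooth function with $\operatorname{rank}\frac{\partial F}{\partial p}=n-m$. The control system is the implicit equation $F(x,\dot x)=0$. It is assumed that for each $x$ there is at least one $p$ with $F(x,p)=0$, and more generally that the manifold $F(x,p)=0$ is parameterized by a smooth function $f:\mathbb{R}^n\times\mathbb{R}^m\to\mathbb{R}^n$ with $F(x,f(x,u))=0$, such that for each fixed $x$ the map $u\mapsto f(x,u)$ is a diffeomorphism onto $\{p:F(x,p)=0\}$. A solution of the system is a smooth function $x(t)$ on an open interval with values in $\mathbb{R}^n$ such that $F(x(t),\dot x(t))=0$ for all $t$. Parameter function. A smooth function $\varphi(y_0,\dots,y_r)$ on $(\mathbb{R}^m)^{r+1}$ with values in $\mathbb{R}^n$ is a parameter function for the system if for every smooth $y:\mathbb{R}\to\mathbb{R}^m$, the function $x(t)=\varphi(y(t),\dot y(t),\dots,y^{(r)}(t))$ satisfies $F(x(t),\frac{d}{dt}x(t))=0$ for all $t$. Equivalently, for all $y_0,\dots,y_{r+1}\in\mathbb{R}^m$, $F(\varphi(y_0,\dots,y_r),\mathcal{L}_\tau\varphi(y_0,\dots,y_{r+1}))=0$, where $\mathcal{L}_\tau\varphi(y_0,\dots,y_{r+1})=\sum_{i=0}^r\frac{\partial\varphi}{\partial y_i}(y_0,\dots,y_r)\,y_{i+1}$. Differential flatness. The system $F(x,\dot x)=0$ is differentially flat if there exist a parameter function $\varphi(y_0,\dots,y_r)$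 and a smooth function $\psi(x_0,\dots,x_s)$ with values in $\mathbb{R}^m$ (where $x_0,\dots,x_s\in\mathbb{R}^n$) such that, for every solution $x(t)$ of the system and every smooth $\mathbb{R}^m$-valued function $y(t)$ on the same open interval, $x=\varphi(y,\dot y,\dots,y^{(r)})$ if and only if $y=\psi(x,\dot x,\dots,x^{(s)})$. Such a $\varphi$ is said to be associated to the flat system. *)

(* Defs.v *)
From HB Require Import structures.
From mathcomp Require Import all_boot all_order all_algebra.
From mathcomp Require Import all_classical all_reals all_analysis.
Set Implicit Arguments.
Unset Strict Implicit.
Unset Printing Implicit Defensive.
Import Order.TTheory GRing.Theory Num.Theory.
Import numFieldNormedType.Exports.
Local Open Scope classical_set_scope.
Local Open Scope ring_scope.

(* [U] is meant to be open and [V] finite-dimensional, where this is the usual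
   class C^k: the directional derivatives 'd f ^~ v determine the full
   derivative. The values of [f] outside of [U] do not matter. *)
Fixpoint Ck_on (R : realType) (V W : normedModType R) (k : nat) (U : set V)
    (f : V -> W) : Prop :=
  match k with
  | 0 => forall x, U x -> {for x, continuous f}
  | k'.+1 => (forall x, U x -> differentiable f x) /\
             (forall v : V, Ck_on k' U (fun x => 'd f x v))
  end.

Definition smooth (R : realType) (V W : normedModType R) (U : set V)
    (f : V -> W) : Prop := forall k : nat, Ck_on k U f.

(* Smoothness on an arbitrary subset [A]: local existence of smooth extensions
   to open sets. On an embedded submanifold this agrees with smoothness for the
   submanifold structure. *)
Definition smooth_on_subset (R : realType) (V W : normedModType R) (A : set V)
    (f : V -> W) : Prop :=
  forall a, A a -> exists (U : set V) (g : V -> W),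
    [/\ open U, U a, smooth U g & forall x, U x -> A x -> f x = g x].

Definition diffeomorphism (R : realType) (V W : normedModType R)
    (A : set V) (B : set W) (f : V -> W) : Prop :=
  [/\ set_bij A B f, smooth_on_subset A f &
      exists g : W -> V,
        (forall x, A x -> g (f x) = x) /\ smooth_on_subset B g].

Section ControlSystem.
Variables (R : realType) (n m : nat).
Variable F : 'rV[R]_n * 'rV[R]_n -> 'rV[R]_(n - m).

(* The last two clauses: F(x,p) = 0 is solvable in p for each x, and the set
   F(x,p) = 0 is globally parameterized by some f(x,u), u in R^m. *)
Definition control_system : Prop :=
  [/\ smooth setT F,
      forall x p, \rank (jacobian (fun q => F (x, q)) p) = (n - m)%N,
      forall x, exists p, F (x, p) = 0 &
      exists f : 'rV[R]_n * 'rV[R]_m -> 'rV[R]_n,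
        [/\ smooth setT f,
            forall x u, F (x, f (x, u)) = 0 &
            forall x, diffeomorphism setT [set p | F (x, p) = 0]
                        (fun u => f (x, u))]].

Definition solution (I : set R) (x : R -> 'rV[R]_n) : Prop :=
  smooth I x /\ forall t, I t -> F (x t, derive1 x t) = 0.

(* (R^d)^(r+1) is encoded as 'M_(r.+1, d), with y_i the i-th row. *)
Definition jet (d r : nat) (y : R -> 'rV[R]_d) (t : R) : 'M[R]_(r.+1, d) :=
  \matrix_(i < r.+1) derive1n i y t.

Definition parameter_function (r : nat)
    (phi : 'M[R]_(r.+1, m) -> 'rV[R]_n) : Prop :=
  smooth setT phi /\
  forall y : R -> 'rV[R]_m, smooth setT y ->
    let x := fun t => phi (jet r y t) in
    forall t, F (x t, derive1 x t) = 0.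

Definition associated (r : nat) (phi : 'M[R]_(r.+1, m) -> 'rV[R]_n) : Prop :=
  parameter_function phi /\
  exists (s : nat) (psi : 'M[R]_(s.+1, n) -> 'rV[R]_m),
    smooth setT psi /\
    forall (I : set R) (x : R -> 'rV[R]_n) (y : R -> 'rV[R]_m),
      open I -> is_interval I -> solution I x -> smooth I y ->
      (forall t, I t -> x t = phi (jet r y t)) <->
      (forall t, I t -> y t = psi (jet s x t)).

Definition differentially_flat : Prop :=
  exists (r : nat) (phi : 'M[R]_(r.+1, m) -> 'rV[R]_n), associated phi.

Definition equilibria : set 'rV[R]_n := [set x | F (x, 0) = 0].

Definition equilibrium_manifold : set ('rV[R]_n * 'rV[R]_n) :=
  [set xp | xp.2 = 0 /\ F xp = 0].

End ControlSystem.

Section LieDerivative.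
Variables (R : realType) (n m r : nat) (phi : 'M[R]_(r.+1, m) -> 'rV[R]_n).

Definition set_row (i : 'I_r.+1) (Y : 'M[R]_(r.+1, m)) (z : 'rV[R]_m) :
    'M[R]_(r.+1, m) :=
  \matrix_(k < r.+1) (if k == i then z else row k Y).

(* (d phi / d y_i) (y_0, ..., y_r) v *)
Definition partial (i : 'I_r.+1) (Y : 'M[R]_(r.+1, m)) (v : 'rV[R]_m) :
    'rV[R]_n := 'd (fun z => phi (set_row i Y z)) (row i Y) v.

(* (y_0, ..., y_(r+1)) |-> (y_0, ..., y_r) *)
Definition drop_last (Y : 'M[R]_(r.+2, m)) : 'M[R]_(r.+1, m) :=
  \matrix_(i < r.+1) row (widen_ord (leqnSn r.+1) i) Y.

Definition Lie_tau (Y : 'M[R]_(r.+2, m)) : 'rV[R]_n :=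
  \sum_(i < r.+1) partial i (drop_last Y) (row (lift ord0 i) Y).

Definition Phi (Y : 'M[R]_(r.+2, m)) : 'rV[R]_n * 'rV[R]_n :=
  (phi (drop_last Y), Lie_tau Y).

End LieDerivative.

(* (y_0, 0, ..., 0) *)
Definition const_jet (R : realType) (m r : nat) (y0 : 'rV[R]_m) :
    'M[R]_(r.+1, m) :=
  \matrix_(i < r.+1) (if i == ord0 then y0 else 0).

(* Main.v *)
Require Import Defs.
From HB Require Import structures.
From mathcomp Require Import all_boot all_order all_algebra.
From mathcomp Require Import all_classical all_reals all_analysis.
Import Order.TTheory GRing.Theory Num.Theory.
Import numFieldNormedType.Exports.
Local Open Scope classical_set_scope.
Local Open Scope ring_scope.

(** Over a constant curve the flatness correspondence x = phi(jet y),
    y = psi(jet x) becomes a correspondence between points. A constant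
    trajectory at x solves the system exactly when F(x, 0) = 0. The jet of the
    constant curve y is (y, 0, ..., 0), so the parameter function property,
    applied to constant curves, sends each y to an equilibrium
    ([parameter_function_equilibrium]). Conversely, flatness on the whole line,
    applied to a constant solution x and a constant y, says that x = phi(y, 0,
    ..., 0) if and only if y = psi(x, 0, ..., 0) ([associated_equilibria]). Hence
    x |-> psi(x, 0, ..., 0) inverts y |-> phi(y, 0, ..., 0) on the equilibria, and
    both maps are smooth because phi and psi are, being only precomposed with
    linear maps ([smooth_comp_linear]).

    The Lie derivative is linear in (y_1, ..., y_(r+1)), so Phi sends
    (y, 0, ..., 0) to (phi(y, 0, ..., 0), 0) ([Phi_const_jet]). The statement about
    Phi is therefore the one about y |-> phi(y, 0, ..., 0), transported by the
    linear embeddings y |-> (y, 0, ..., 0) and x |-> (x, 0). *)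

(** * Smoothness and linear maps *)

(** Expanding the argument in the matrix units makes L a finite sum of entries
    times constant vectors. *)
Lemma continuous_linear_matrix (R : realType) (a b : nat)
    (V : normedModType R) (L : {linear 'M[R]_(a, b) -> V}) : continuous L.
Proof.
have -> : (L : 'M[R]_(a, b) -> V) =
    fun M => \sum_(i < a) \sum_(j < b) M i j *: L (delta_mx i j).
  apply: funext => M; rewrite {1}(matrix_sum_delta M) linear_sum.
  by apply: eq_bigr => i _; rewrite linear_sum; apply: eq_bigr => j _;
    rewrite linearZ.
apply: continuous_big => [|i _]; first exact: add_continuous.
apply: continuous_big => [|j _]; first exact: add_continuous.
move=> M; apply: (@cvgZr_tmp R V _ (nbhs M)); exact: coord_continuous.
Qed.

(** The directional derivative of B o f o A along v is B o (df along A v) o A,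
    again of the same form, so the induction on the order closes. *)
Lemma Ck_on_linear_comp (R : realType) (U V W X : normedModType R)
    (A : {linear U -> V}) (B : {linear W -> X}) (k : nat) (f : V -> W) :
  continuous A -> continuous B ->
  Ck_on k setT f -> Ck_on k setT (B \o f \o A).
Proof.
move=> cA cB; elim: k f => [|k IHk] f /=.
  move=> cf x _; apply: continuous_comp; first exact: cA.
  by apply: continuous_comp; [exact: cf | exact: cB].
move=> [df Ckf].
have dA x : differentiable A x by exact: linear_differentiable.
have dB y : differentiable B y by exact: linear_differentiable.
have dfA x : differentiable f (A x) by exact: df.
split=> [x _|v].
  by do 2?apply: differentiable_comp => //; apply: differentiable_comp.
have -> : (fun x => 'd (B \o f \o A) x v) =
    B \o (fun y => 'd f y (A v)) \o A; last exact: IHk.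
apply: funext => x.
rewrite diff_comp //; last exact: differentiable_comp.
by rewrite diff_comp //= !diff_lin.
Qed.

Lemma smooth_linear_comp (R : realType) (U V W X : normedModType R)
    (A : {linear U -> V}) (B : {linear W -> X}) (f : V -> W) :
  continuous A -> continuous B ->
  smooth setT f -> smooth setT (B \o f \o A).
Proof. by move=> cA cB sf k; apply: Ck_on_linear_comp. Qed.

Lemma smooth_comp_linear (R : realType) (U V W : normedModType R)
    (A : {linear U -> V}) (f : V -> W) :
  continuous A -> smooth setT f -> smooth setT (f \o A).
Proof.
move=> cA sf; apply: (smooth_linear_comp _ _ _ _ _ _ idfun) => //.
by move=> x.
Qed.

Lemma smooth_cst (R : realType) (V W : normedModType R) (U : set V) (a : W) :
  smooth U (cst a : V -> W).
Proof.
move=> k; elim: k a => [|k IHk] a /=; first by move=> x _; exact: cst_continuous.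
split=> [x _|v]; first exact: differentiable_cst.
have -> : (fun x => 'd (cst a : V -> W) x v) = cst 0 by
  apply: funext => x; rewrite diff_cst.
exact: IHk.
Qed.

(** One global smooth function agreeing with f on A serves as the local
    extension at every point of A. *)
Lemma smooth_on_subset_restrict (R : realType) (V W : normedModType R)
    (A : set V) (f g : V -> W) :
  smooth setT g -> {in A, f =1 g} -> smooth_on_subset A f.
Proof.
move=> sg fg a Aa; exists setT, g; split=> //; first exact: openT.
by move=> x _ Ax; apply: fg; rewrite inE.
Qed.

(** * Constant jets *)

Lemma const_jet_linear (R : realType) (m r : nat) : linear (@const_jet R m r).
Proof.
move=> a y z; apply/matrixP => i j; rewrite !mxE.
by case: ifP; rewrite !mxE // mulr0 addr0.
Qed.

HB.instance Definition _ (R : realType) (m r : nat) :=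
  GRing.isLinear.Build R _ _ _ (@const_jet R m r) (@const_jet_linear R m r).

Lemma drop_last_linear (R : realType) (m r : nat) : linear (@drop_last R m r).
Proof. by move=> a Y Z; apply/matrixP => i j; rewrite !mxE. Qed.

HB.instance Definition _ (R : realType) (m r : nat) :=
  GRing.isLinear.Build R _ _ _ (@drop_last R m r) (@drop_last_linear R m r).

Definition at_rest {R : realType} {n : nat} (x : 'rV[R]_n) :
    'rV[R]_n * 'rV[R]_n := (x, 0).

Lemma at_rest_linear (R : realType) (n : nat) : linear (@at_rest R n).
Proof. by move=> a x y; congr pair; rewrite /= scaler0 addr0. Qed.

HB.instance Definition _ (R : realType) (n : nat) :=
  GRing.isLinear.Build R _ _ _ (@at_rest R n) (@at_rest_linear R n).

Lemma drop_last_const_jet (R : realType) (m r : nat) (y : 'rV[R]_m) :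
  drop_last (const_jet r.+1 y) = const_jet r y.
Proof. by apply/matrixP => i j; rewrite !mxE. Qed.

Lemma jet_cst (R : realType) (m r : nat) (y : 'rV[R]_m) (t : R) :
  jet r (cst y) t = const_jet r y.
Proof.
have d1 (z : 'rV[R]_m) : derive1 (cst z : R -> 'rV[R]_m) = cst 0.
  by apply: funext => u; exact: derive1_cst.
have dS i : derive1n i.+1 (cst y : R -> 'rV[R]_m) = cst 0.
  by elim: i => [|i IHi]; rewrite derive1nS ?IHi d1.
apply/row_matrixP => -[[|i] lti]; rewrite !rowK //.
by rewrite dS.
Qed.

(** Every term of the Lie derivative is a differential evaluated at some y_(i+1),
    which vanishes here. *)
Lemma Phi_const_jet (R : realType) (n m r : nat)
    (phi : 'M[R]_(r.+1, m) -> 'rV[R]_n) (y : 'rV[R]_m) :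
  Phi phi (const_jet r.+1 y) = at_rest (phi (const_jet r y)).
Proof.
rewrite /Phi drop_last_const_jet; congr pair.
by apply: big1 => i _; rewrite rowK /partial linear0.
Qed.

(** * Flatness at equilibria *)

Section Equilibria.
Variables (R : realType) (n m : nat).
Variable F : 'rV[R]_n * 'rV[R]_n -> 'rV[R]_(n - m).

Lemma solution_cst (x : 'rV[R]_n) : F (x, 0) = 0 -> solution F setT (cst x).
Proof.
by move=> Fx; split=> [|t _]; [exact: smooth_cst | rewrite derive1_cst].
Qed.

Lemma parameter_function_equilibrium (r : nat)
    (phi : 'M[R]_(r.+1, m) -> 'rV[R]_n) (y : 'rV[R]_m) :
  parameter_function F phi -> F (phi (const_jet r y), 0) = 0.
Proof.
move=> [_ /(_ (cst y) (smooth_cst _ _ _ _ _) 0)] /=.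
under [X in derive1 X]eq_fun do rewrite jet_cst.
by rewrite jet_cst derive1_cst.
Qed.

(** Both constant curves are smooth on the whole line, which is an admissible
    time interval; evaluating the correspondence at time 0 gives the two
    implications between points. *)
Lemma associated_equilibria (r : nat) (phi : 'M[R]_(r.+1, m) -> 'rV[R]_n) :
  associated F phi ->
  exists s (psi : 'M[R]_(s.+1, n) -> 'rV[R]_m),
    smooth setT psi /\
    forall x, F (x, 0) = 0 ->
    forall y, x = phi (const_jet r y) <-> y = psi (const_jet s x).
Proof.
move=> [_ [s [psi [spsi duality]]]]; exists s, psi; split=> // x Fx y.
have [xy yx] := duality setT (cst x) (cst y) openT
  (fun _ _ _ _ _ _ => I) (solution_cst x Fx) (smooth_cst _ _ _ _ _).
split=> [e|e].
- by have := xy _ 0 I; rewrite jet_cst; apply=> t _; rewrite jet_cst.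
- by have := yx _ 0 I; rewrite jet_cst; apply=> t _; rewrite jet_cst.
Qed.

End Equilibria.

Theorem proposition3p2 (R : realType) (n m : nat)
    (F : 'rV[R]_n * 'rV[R]_n -> 'rV[R]_(n - m))
    (hm : (0 < m)%N) (hnm : (m < n)%N)
    (hF : control_system F) (hflat : differentially_flat F)
    (r : nat) (phi : 'M[R]_(r.+1, m) -> 'rV[R]_n)
    (hphi : associated F phi) :
  diffeomorphism (range (@const_jet R m r.+1)) (equilibrium_manifold F)
    (Phi phi)
  /\ diffeomorphism setT (equilibria F) (fun y0 => phi (const_jet r y0)).
Proof.
have Fphi y : F (phi (const_jet r y), 0) = 0.
  exact: (parameter_function_equilibrium _ _ _ _ _ _ _ hphi.1).
have sphi : smooth setT phi by case: hphi => -[].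
have [s [psi [spsi duality]]] := associated_equilibria _ _ _ _ _ _ hphi.
have psiK y : psi (const_jet s (phi (const_jet r y))) = y.
  exact/esym/(duality _ (Fphi y) y).
have phiK x : F (x, 0) = 0 -> phi (const_jet r (psi (const_jet s x))) = x.
  by move=> Fx; exact/esym/(duality _ Fx).
split; split.
- split=> [_ [y _ <-]|_ _ /set_mem[y _ <-] /set_mem[z _ <-]|[x p] [/= -> Fx]].
  + by rewrite Phi_const_jet; split=> //=; exact: Fphi.
  + by rewrite !Phi_const_jet => -[eyz]; rewrite -(psiK y) eyz psiK.
  + exists (const_jet r.+1 (psi (const_jet s x))).
      by exists (psi (const_jet s x)).
    by rewrite Phi_const_jet phiK.
- (* On constant jets Phi coincides with (phi, 0), which is phi composed with
     linear maps on both sides. *)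
  apply: (smooth_on_subset_restrict _ _ _ _ _
    (at_rest \o phi \o @drop_last R m r)).
    by apply: smooth_linear_comp => //; exact: continuous_linear_matrix.
  by move=> _ /set_mem[y _ <-]; rewrite Phi_const_jet /= drop_last_const_jet.
- exists (@const_jet R m r.+1 \o (psi \o const_jet s) \o fst); split.
    by move=> _ [y _ <-]; rewrite Phi_const_jet /= psiK.
  apply: smooth_on_subset_restrict => //.
  apply: smooth_linear_comp; [by move=> ?; exact: cvg_fst
    | exact: continuous_linear_matrix |].
  by apply: smooth_comp_linear => //; exact: continuous_linear_matrix.
- split=> [y _|y z _ _ /= eyz|x Fx].
  + exact: Fphi.
  + by rewrite -(psiK y) eyz psiK.
  + by exists (psi (const_jet s x)) => //; exact: phiK.
- apply: (smooth_on_subset_restrict _ _ _ _ _ (phi \o const_jet r)) => //.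
  by apply: smooth_comp_linear => //; exact: continuous_linear_matrix.
- exists (psi \o const_jet s); split=> [y _|]; first exact: psiK.
  apply: smooth_on_subset_restrict => //.
  by apply: smooth_comp_linear => //; exact: continuous_linear_matrix.
Qed.
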